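(* Let $f,g:\mathbb{R}^n\times\mathbb{R}^p\to\mathbb{R}$ satisfy the standing assumptions (A1)–(A2) below, let $\beta>0$, and define $\mathcal{A}$, $h$, $\mathcal{M}$ as below. Suppose $\beta\ge \frac{2Q_gM_f}{\mu^3}$. If $(x,y)\in\mathbb{R}^n\times\mathbb{R}^p$ is a first-order stationary point of (CDB), i.e. $0\in\partial h(x,y)$, then $(x,y)\in\mathcal{M}$, and hence $(x,y)$ is a first-order stationary point of (BLO).
   Context: Standing assumptions. (A1) Constants $M_f,\mu,L_g,Q_g>0$ exist such that: $f$ is (possibly nonsmooth and) $M_f$-Lipschitz continuous on $\mathbb{R}^n\times\mathbb{R}^p$; $g$ is twice differentiable with $\nabla^2_{yy}g(x,y)\succeq\mu I_p$ for all $(x,y)$; $\nabla g$ is $L_g$-Lipschitz; $\nabla^2_{yy}g$ and $\nabla^2_{xy}g$ are $Q_g$-Lipschitz; $\nabla^2_{yy}g$ is continuously differentiable. Here $\nabla^2_{xy}g(x,y)\in\mathbb{R}^{n\times p}$ has entries $\partial^2 g/\partial x_i\partial y_j$, and $\nabla^2_{yx}g=(\nabla^2_{xy}g)^\top$. (A2) $f$ is a potential function of a conservative field $\mathcal{D}_f:\mathbb{R}^n\times\mathbb{R}^p\rightrightarrows\mathbb{R}^n\times\mathbb{R}^p$ with compact convex values and $\sup_{(x,y),\,\xi\in\mathcal{D}_f(x,y)}\|\xi\|\le M_f$. (A set-valued map $\mathcal{D}$ is a conservative field if it has closed graph, nonempty compact values, and $\int_0^1\max_{v\in\mathcal{D}(\gamma(t))}\langle\gamma'(t),v\rangle\,dt=0$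 for every absolutely continuous $\gamma:[0,1]\to\mathbb{R}^n\times\mathbb{R}^p$ with $\gamma(0)=\gamma(1)$; $f$ is a potential of $\mathcal{D}$ if $f(\gamma(1))=f(\gamma(0))+\int_0^1\max_{v\in\mathcal{D}(\gamma(t))}\langle\gamma'(t),v\rangle\,dt$ for every absolutely continuous curve $\gamma$.) Notation: $\mathcal{A}(x,y):=y-\nabla^2_{yy}g(x,y)^{-1}\nabla_yg(x,y)$; $h(x,y):=f(x,\mathcal{A}(x,y))+\frac{\beta}{2}\|\nabla_yg(x,y)\|^2$ (problem (CDB) is $\min_{x,y}h$); (BLO) is $\min_{x,y} f(x,y)$ s.t. $y=\arg\min_{y'}g(x,y')$; $\mathcal{M}:=\{(x,y):\nabla_yg(x,y)=0\}$; $\partial$ denotes the Clarke subdifferential. $(x,y)$ is a first-order stationary point of (BLO) if there is $(d_x,d_y)\in\partial f(x,y)$ with $d_x-\nabla^2_{xy}g(x,y)\nabla^2_{yy}g(x,y)^{-1}d_y=0$ and $\nabla_yg(x,y)=0$. *)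

(* Defs.v *)
From HB Require Import structures.
From mathcomp Require Import all_boot all_order all_algebra.
From mathcomp Require Import all_classical all_reals all_analysis.
Set Implicit Arguments. Unset Strict Implicit. Unset Printing Implicit Defensive.
Import Order.TTheory GRing.Theory Num.Theory.
Import numFieldNormedType.Exports.
Local Open Scope classical_set_scope.
Local Open Scope ring_scope.

Definition dotv {R : realType} {k : nat} (u v : 'rV[R]_k) : R := (u *m v^T) 0 0.
Definition enorm {R : realType} {k : nat} (u : 'rV[R]_k) : R := Num.sqrt (dotv u u).

Definition pdot {R : realType} {n p : nat} (z w : 'rV[R]_n * 'rV[R]_p) : R :=
  dotv z.1 w.1 + dotv z.2 w.2.
Definition pnorm {R : realType} {n p : nat} (z : 'rV[R]_n * 'rV[R]_p) : R :=
  Num.sqrt (pdot z z).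

(* Clarke generalized directional derivative
   F°(z; v) = limsup_{z' -> z, t -> 0+} (F (z' + t v) - F z') / t,
   written out as inf_{d > 0} sup { ... : |z' - z| < d, 0 < t < d }. *)
Definition clarke_dd {R : realType} {n p : nat}
    (F : 'rV[R]_n * 'rV[R]_p -> R) (z v : 'rV[R]_n * 'rV[R]_p) : \bar R :=
  ereal_inf [set ereal_sup
      [set ((F (z' + t *: v) - F z') / t)%:E
         | z' in [set z' : 'rV[R]_n * 'rV[R]_p | pnorm (z' - z) < d]
         & t in [set t : R | 0 < t < d]]
    | d in [set d : R | 0 < d]].

Definition clarke_subdiff {R : realType} {n p : nat}
    (F : 'rV[R]_n * 'rV[R]_p -> R) (z : 'rV[R]_n * 'rV[R]_p)
    : set ('rV[R]_n * 'rV[R]_p) :=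
  [set xi | forall v, (pdot xi v)%:E <= clarke_dd F z v]%E.

Definition abs_cont_curve {R : realType} {n p : nat}
    (gamma : R -> 'rV[R]_n * 'rV[R]_p) : Prop :=
  forall e : R, 0 < e -> exists2 d : R, 0 < d &
    forall (k : nat) (a b : nat -> R),
      (forall i, (i < k)%N -> 0 <= a i /\ a i <= b i /\ b i <= 1) ->
      (forall i j, (i < k)%N -> (j < k)%N -> i <> j -> b i <= a j \/ b j <= a i) ->
      \sum_(i < k) (b i - a i) < d ->
      \sum_(i < k) pnorm (gamma (b i) - gamma (a i)) < e.

Definition field_integral {R : realType} {n p : nat}
    (D : 'rV[R]_n * 'rV[R]_p -> set ('rV[R]_n * 'rV[R]_p))
    (gamma : R -> 'rV[R]_n * 'rV[R]_p) : \bar R :=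
  (\int[lebesgue_measure]_(t in `[0%R, 1%R])
     (sup [set pdot (derive1 gamma t) v | v in D (gamma t)])%:E)%E.

Definition conservative_field {R : realType} {n p : nat}
    (D : 'rV[R]_n * 'rV[R]_p -> set ('rV[R]_n * 'rV[R]_p)) : Prop :=
  [/\ closed [set zv : ('rV[R]_n * 'rV[R]_p) * ('rV[R]_n * 'rV[R]_p) | D zv.1 zv.2],
      (forall z, D z !=set0),
      (forall z, compact (D z)) &
      (forall gamma, abs_cont_curve gamma -> gamma 0 = gamma 1 ->
         field_integral D gamma = 0%E)].

Definition potential_of {R : realType} {n p : nat}
    (f : 'rV[R]_n * 'rV[R]_p -> R)
    (D : 'rV[R]_n * 'rV[R]_p -> set ('rV[R]_n * 'rV[R]_p)) : Prop :=
  forall gamma, abs_cont_curve gamma ->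
    (f (gamma 1))%:E = ((f (gamma 0))%:E + field_integral D gamma)%E.

Definition convex_pset {R : realType} {n p : nat}
    (S : set ('rV[R]_n * 'rV[R]_p)) : Prop :=
  forall a b (l : R), S a -> S b -> 0 <= l <= 1 -> S (l *: a + (1 - l) *: b).

(* Main.v *)
Require Import Defs.
From HB Require Import structures.
From mathcomp Require Import all_boot all_order all_algebra.
From mathcomp Require Import all_classical all_reals all_analysis.
From mathcomp Require Import ring lra.
Import Order.TTheory GRing.Theory Num.Theory.
Import numFieldNormedType.Exports.
Local Open Scope classical_set_scope.
Local Open Scope ring_scope.

(** Write z = (x, y), G(v) = v1 Hxy(z) + v2 Hyy(z) for the derivative of gy at z
    along v, and N(z) = (x, A(z)). Lipschitz estimates of the difference quotients
    of gy and of Hyy^-1 show, with no chain rule for Clarke subdifferentials, that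
      h°(z; v) <= f°(N(z); (v1, v2 - G(v) Hyy(z)^-1))
                  + Mf Qg |v| |gy(z)| / mu^2 + beta <G(v), gy(z)>.
    The Newton direction v = (0, - gy(z) Hyy(z)^-1) kills the first term and makes
    the last one - beta |gy(z)|^2, which the second cannot compensate when
    beta >= 2 Qg Mf / mu^3; so 0 <= h°(z; v) forces gy(z) = 0. Then N(z) = z, and
    v = (u, 0) gives 0 <= f°(z; (u, - u Hxy Hyy^-1)) for every u. By Hahn-Banach the
    zero functional on this subspace extends to a linear d <= f°(z; .), which is
    the required Clarke subgradient. The derivative of A drops its v2-part only
    because Hyy is symmetric, which follows from second differences of g. *)

(** * Euclidean inner products and norms of row vectors and of pairs *)

Section euclidean.
Set Implicit Arguments.
Unset Strict Implicit.
Context {R : realType}.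
Implicit Types k n p : nat.

Lemma dotvE k (u v : 'rV[R]_k) : dotv u v = \sum_i u 0 i * v 0 i.
Proof. by rewrite /dotv mxE; apply: eq_bigr => i _; rewrite mxE. Qed.

Lemma dotvC k (u v : 'rV[R]_k) : dotv u v = dotv v u.
Proof. by rewrite !dotvE; apply: eq_bigr => i _; rewrite mulrC. Qed.

Lemma dotvDl k (u v w : 'rV[R]_k) : dotv (u + v) w = dotv u w + dotv v w.
Proof. by rewrite /dotv mulmxDl mxE. Qed.

Lemma dotvZl k a (u v : 'rV[R]_k) : dotv (a *: u) v = a * dotv u v.
Proof. by rewrite /dotv -scalemxAl mxE. Qed.

Lemma dotvNl k (u v : 'rV[R]_k) : dotv (- u) v = - dotv u v.
Proof. by rewrite -scaleN1r dotvZl mulN1r. Qed.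

Lemma dotvBl k (u v w : 'rV[R]_k) : dotv (u - v) w = dotv u w - dotv v w.
Proof. by rewrite dotvDl dotvNl. Qed.

Lemma dotvDr k (u v w : 'rV[R]_k) : dotv u (v + w) = dotv u v + dotv u w.
Proof. by rewrite !(dotvC u) dotvDl. Qed.

Lemma dotvZr k a (u v : 'rV[R]_k) : dotv u (a *: v) = a * dotv u v.
Proof. by rewrite !(dotvC u) dotvZl. Qed.

Lemma dotvNr k (u v : 'rV[R]_k) : dotv u (- v) = - dotv u v.
Proof. by rewrite !(dotvC u) dotvNl. Qed.

Lemma dotvBr k (u v w : 'rV[R]_k) : dotv u (v - w) = dotv u v - dotv u w.
Proof. by rewrite dotvDr dotvNr. Qed.

Lemma dotv0l k (u : 'rV[R]_k) : dotv 0 u = 0.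
Proof. by rewrite /dotv mul0mx mxE. Qed.

Lemma dotv0r k (u : 'rV[R]_k) : dotv u 0 = 0.
Proof. by rewrite dotvC dotv0l. Qed.

Lemma dotv_mulmx k n (u : 'rV[R]_k) (M : 'M[R]_(k, n)) (v : 'rV[R]_n) :
  dotv (u *m M) v = dotv u (M *m v^T)^T.
Proof. by rewrite /dotv trmxK mulmxA. Qed.

Lemma dotv_ge0 k (u : 'rV[R]_k) : 0 <= dotv u u.
Proof. by rewrite dotvE sumr_ge0// => i _; rewrite -expr2 sqr_ge0. Qed.

Lemma dotv_eq0 k (u : 'rV[R]_k) : dotv u u = 0 -> u = 0.
Proof.
rewrite dotvE => /eqP; rewrite psumr_eq0; last by move=> i _; rewrite -expr2 sqr_ge0.
move=> /allP u0; apply/rowP => i; rewrite mxE; apply/eqP.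
by have := u0 i (mem_index_enum _); rewrite mulf_eq0 orbb.
Qed.

Lemma dotv_nondegenerate k (u : 'rV[R]_k) : (forall v, dotv u v = 0) -> u = 0.
Proof. by move=> /(_ u)/dotv_eq0. Qed.

Lemma enorm_ge0 k (u : 'rV[R]_k) : 0 <= enorm u.
Proof. exact: sqrtr_ge0. Qed.

Lemma enorm_sqr k (u : 'rV[R]_k) : enorm u ^+ 2 = dotv u u.
Proof. by rewrite sqr_sqrtr ?dotv_ge0. Qed.

Lemma enorm_eq0 k (u : 'rV[R]_k) : enorm u = 0 -> u = 0.
Proof. by move=> u0; apply: dotv_eq0; rewrite -enorm_sqr u0 expr0n. Qed.

Lemma enormZ k a (u : 'rV[R]_k) : enorm (a *: u) = `|a| * enorm u.
Proof.
by rewrite /enorm dotvZl dotvZr mulrA -expr2 sqrtrM ?sqr_ge0// sqrtr_sqr.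
Qed.

Lemma enormN k (u : 'rV[R]_k) : enorm (- u) = enorm u.
Proof. by rewrite -scaleN1r enormZ normrN1 mul1r. Qed.

Lemma enorm0 k : enorm (0 : 'rV[R]_k) = 0.
Proof. by rewrite /enorm dotv0l sqrtr0. Qed.

(** Cauchy-Schwarz, from the squared norm of [enorm v *: u - enorm u *: v], which factors as
    [2 * (a * b) * (a * b - c)]; zero norms are set aside to cancel [a * b]. *)
Lemma dotv_le_enorm k (u v : 'rV[R]_k) : dotv u v <= enorm u * enorm v.
Proof.
have [u0|un0] := eqVneq (enorm u) 0.
  by rewrite (enorm_eq0 u0) dotv0l enorm0 mul0r.
have [v0|vn0] := eqVneq (enorm v) 0.
  by rewrite (enorm_eq0 v0) dotvC dotv0l enorm0 mulr0.
have ugt0 : 0 < enorm u by rewrite lt_def un0 enorm_ge0.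
have vgt0 : 0 < enorm v by rewrite lt_def vn0 enorm_ge0.
have := dotv_ge0 (enorm v *: u - enorm u *: v).
rewrite !(dotvBl, dotvBr, dotvZl, dotvZr) -!enorm_sqr (dotvC v u).
set a := enorm u in ugt0 *; set b := enorm v in vgt0 *; set c := dotv u v.
rewrite (_ : _ - _ = 2 * (a * b) * (a * b - c)); last by ring.
by rewrite pmulr_rge0 ?subr_ge0// mulr_gt0// mulr_gt0.
Qed.

Lemma ler_enormD k (u v : 'rV[R]_k) : enorm (u + v) <= enorm u + enorm v.
Proof.
rewrite -(@ler_pXn2r _ 2%N) ?nnegrE ?addr_ge0 ?enorm_ge0// sqrrD !enorm_sqr.
rewrite !(dotvDl, dotvDr) (dotvC v u).
by have := dotv_le_enorm u v; lra.
Qed.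

Lemma ler_enormB k (u v : 'rV[R]_k) : enorm (u - v) <= enorm u + enorm v.
Proof. by rewrite -(enormN v) ler_enormD. Qed.

(** Testing with [u] itself suffices. This form lets a vector estimate follow from the scalar mean
    value theorem, whose intermediate point changes with the test vector. *)
Lemma enorm_le_dual k (u : 'rV[R]_k) (c : R) : 0 <= c ->
  (forall v, dotv u v <= c * enorm v) -> enorm u <= c.
Proof.
move=> c0 /(_ u); rewrite -enorm_sqr expr2.
have [->//|un0] := eqVneq (enorm u) 0.
by rewrite ler_pM2r// lt_def un0 enorm_ge0.
Qed.

(** Concatenation is an isometry, through which [pnorm] inherits homogeneity and the triangle
    inequality. *)
Lemma pdot_row_mx n p (z w : 'rV[R]_n * 'rV[R]_p) :
  pdot z w = dotv (row_mx z.1 z.2) (row_mx w.1 w.2).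
Proof. by rewrite /pdot /dotv tr_row_mx mul_row_col [RHS]mxE. Qed.

Lemma pnorm_row_mx n p (z : 'rV[R]_n * 'rV[R]_p) :
  pnorm z = enorm (row_mx z.1 z.2).
Proof. by rewrite /pnorm pdot_row_mx. Qed.

Lemma pnorm_ge0 n p (z : 'rV[R]_n * 'rV[R]_p) : 0 <= pnorm z.
Proof. exact: sqrtr_ge0. Qed.

Lemma pnorm0 n p : pnorm (0 : 'rV[R]_n * 'rV[R]_p) = 0.
Proof. by rewrite pnorm_row_mx row_mx0 enorm0. Qed.

Lemma pnormZ n p a (z : 'rV[R]_n * 'rV[R]_p) : pnorm (a *: z) = `|a| * pnorm z.
Proof. by rewrite !pnorm_row_mx -scale_row_mx enormZ. Qed.

Lemma pnormN n p (z : 'rV[R]_n * 'rV[R]_p) : pnorm (- z) = pnorm z.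
Proof. by rewrite -scaleN1r pnormZ normrN1 mul1r. Qed.

Lemma ler_pnormD n p (z w : 'rV[R]_n * 'rV[R]_p) :
  pnorm (z + w) <= pnorm z + pnorm w.
Proof. by rewrite !pnorm_row_mx -add_row_mx ler_enormD. Qed.

Lemma enorm_snd_le_pnorm n p (z : 'rV[R]_n * 'rV[R]_p) : enorm z.2 <= pnorm z.
Proof. by rewrite ler_wsqrtr// /pdot lerDr dotv_ge0. Qed.

Lemma enorm_fst_le_pnorm n p (z : 'rV[R]_n * 'rV[R]_p) : enorm z.1 <= pnorm z.
Proof. by rewrite ler_wsqrtr// /pdot lerDl dotv_ge0. Qed.

Lemma pnorm_inr n p (u : 'rV[R]_p) : pnorm ((0, u) : 'rV[R]_n * 'rV[R]_p) = enorm u.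
Proof. by rewrite /pnorm /pdot /= dotv0l add0r. Qed.

Lemma pnorm_le_enormD n p (z : 'rV[R]_n * 'rV[R]_p) :
  pnorm z <= enorm z.1 + enorm z.2.
Proof.
rewrite -(@ler_pXn2r _ 2%N) ?nnegrE ?addr_ge0 ?enorm_ge0 ?pnorm_ge0//.
rewrite sqrrD !enorm_sqr sqr_sqrtr; last by rewrite addr_ge0 ?dotv_ge0.
by rewrite /pdot lerD2r lerDl mulrn_wge0// mulr_ge0 ?enorm_ge0.
Qed.

End euclidean.

(** * Sublinear functionals and Hahn-Banach in finite dimension *)

Section hahn_banach.
Set Implicit Arguments.
Unset Strict Implicit.
Context {R : realType}.

Definition sublinear (V : lmodType R) (q : V -> R) :=
  (forall u v, q (u + v) <= q u + q v) /\
  (forall t v, 0 <= t -> q (t *: v) = t * q v).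

Lemma sublinear0 (V : lmodType R) (q : V -> R) : sublinear q -> q 0 = 0.
Proof. by move=> [_ qZ]; rewrite -(scale0r (0 : V)) qZ// mul0r. Qed.

Lemma sublinear_oppr (V : lmodType R) (q : V -> R) v : sublinear q -> - q (- v) <= q v.
Proof.
by move=> qs; rewrite -subr_ge0 opprK (le_trans _ (qs.1 _ _))// subrr sublinear0.
Qed.

(* The infimal convolution of [q] with [lam] on the range of [w]. *)
Lemma sublinear_dominated (U V : lmodType R) (q : V -> R)
    (w : {linear U -> V}) (lam : {scalar U}) :
  sublinear q -> (forall u, lam u <= q (w u)) ->
  exists q' : V -> R, [/\ sublinear q', forall v, q' v <= q v &
    forall u, q' (w u) <= lam u].
Proof.
move=> qs lamq.
pose S v := [set q (v + w u) - lam u | u in [set: U]].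
(* Subadditivity on [v + w u] and [- v], together with [lamq], keeps the infimum finite. *)
have Slb v : lbound (S v) (- q (- v)).
  move=> _ [u _ <-]; have := qs.1 (v + w u) (- v).
  by rewrite addrAC subrr add0r; have := lamq u; lra.
have Sinf v : has_inf (S v).
  by split; [exists (q (v + w 0) - lam 0), 0|exists (- q (- v)); exact: Slb].
have infSle v u : inf (S v) <= q (v + w u) - lam u.
  by apply: ge_inf; [exact: (Sinf v).2|exists u].
have leinfS v c : (forall u, c <= q (v + w u) - lam u) -> c <= inf (S v).
  move=> cle; apply: lb_le_inf; first exact: (Sinf v).1.
  by move=> _ [u _ <-].
exists (fun v => inf (S v)); split => [|v|u].
- split=> [v1 v2|t v].
    rewrite -lerBlDr; apply: (leinfS) => u1; rewrite lerBlDl -lerBlDr.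
    apply: leinfS => u2; rewrite lerBlDr (le_trans (infSle _ (u1 + u2)))//.
    have := qs.1 (v1 + w u1) (v2 + w u2).
    by rewrite !linearD /= addrACA; lra.
  rewrite le_eqVlt => /predU1P[<-|t0].
    rewrite scale0r mul0r; apply/eqP; rewrite eq_le; apply/andP; split.
      by rewrite (le_trans (infSle 0 0))// !linear0 !addr0 (sublinear0 qs).
    by apply: leinfS => u; rewrite add0r subr_ge0.
  apply/eqP; rewrite eq_le; apply/andP; split; last first.
    apply: leinfS => u.
    have -> : u = t *: (t^-1 *: u) by rewrite scalerKV ?gt_eqF//.
    rewrite linearZZ scalarZ -scalerDr qs.2 ?(ltW t0)//.
    by rewrite -mulrBr ler_pM2l.
  rewrite -ler_pdivrMl//; apply: leinfS => u.
  rewrite ler_pdivrMl// (le_trans (infSle _ (t *: u)))//.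
  by rewrite linearZZ scalarZ -scalerDr qs.2 ?(ltW t0)// mulrBr.
- by rewrite (le_trans (infSle v 0))// !linear0 !addr0.
- rewrite (le_trans (infSle _ (- u)))// !linearN /= subrr (sublinear0 qs).
  by rewrite opprK add0r.
Qed.

(** Infimal convolution with [t *: e |-> t * q e] gives [q1 e <= q e] and [q1 (- e) <= - q e]. Every
    sublinear minorant of [q1] is then odd at [e], being squeezed by [sublinear_oppr], so later
    steps of the induction preserve oddness. *)
Lemma sublinear_dominated_odd (V : lmodType R) (q : V -> R) (s : seq V) :
  sublinear q -> exists q' : V -> R, [/\ sublinear q', forall v, q' v <= q v &
    forall e, e \in s -> q' (- e) = - q' e].
Proof.
elim: s q => [|e s IH] q qs; first by exists q.
have w_lin : linear (fun t : R^o => t *: e).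
  by move=> a x y; rewrite scalerDl scalerA.
pose w : {linear R^o -> V} := HB.pack (fun t : R^o => t *: e)
  (GRing.isLinear.Build _ _ _ _ _ w_lin).
have lam_lin : scalar (fun t : R^o => t * q e).
  by move=> a x y; rewrite mulrDl mulrA.
pose lam : {scalar R^o} := HB.pack (fun t : R^o => t * q e)
  (GRing.isLinear.Build _ _ _ _ _ lam_lin).
have [|q1 [q1s q1q q1w]] := @sublinear_dominated _ _ q w lam qs.
  move=> u; rewrite /w /lam /=; case: (leP 0 u) => u0; first by rewrite qs.2.
  have := sublinear_oppr (u *: e) qs; rewrite -scaleNr qs.2 ?oppr_ge0 ?(ltW u0)//.
  by rewrite mulNr opprK.
have [q2 [q2s q2q1 q2odd]] := IH q1 q1s.
exists q2; split=> // [v|e']; first by rewrite (le_trans (q2q1 v)).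
rewrite inE => /predU1P[->|]; last exact: q2odd.
have := sublinear_oppr e q2s.
have := q1w 1; have := q1w (-1); rewrite /w /lam /= !scaleN1r !scale1r !mulN1r !mul1r.
by have := q2q1 e; have := q2q1 (- e); move=> *; apply/eqP; rewrite eq_le; lra.
Qed.

(** Oddness on the standard basis makes a sublinear minorant homogeneous along each axis, so
    subadditivity puts it below the linear form with the same basis values. Evaluation at [- v]
    reverses the bound. *)
Lemma hahn_banach_pair (n p : nat) (q : 'rV[R]_n * 'rV[R]_p -> R) :
  sublinear q -> exists d, forall v, pdot d v <= q v.
Proof.
move=> qs.
pose e1 i : 'rV[R]_n * 'rV[R]_p := (delta_mx 0 i, 0).
pose e2 j : 'rV[R]_n * 'rV[R]_p := (0, delta_mx 0 j).
have [q' [q's q'q q'odd]] :=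
  sublinear_dominated_odd (codom e1 ++ codom e2) qs.
have odd1 i : q' (- e1 i) = - q' (e1 i) by rewrite q'odd// mem_cat codom_f.
have odd2 j : q' (- e2 j) = - q' (e2 j) by rewrite q'odd// mem_cat codom_f orbT.
have q'Z e a : q' (- e) = - q' e -> q' (a *: e) = a * q' e.
  move=> qN; case: (leP 0 a) => a0; first exact: q's.2.
  have := q's.2 (- a) (- e); rewrite scalerN scaleNr opprK qN mulrNN; apply.
  by rewrite oppr_ge0 ltW.
have q'sum (I : finType) (F : I -> 'rV[R]_n * 'rV[R]_p) :
    q' (\sum_i F i) <= \sum_i q' (F i).
  elim/big_rec2: _ => [|i y v _ IH]; first by rewrite (sublinear0 q's).
  by rewrite (le_trans (q's.1 _ _))// lerD2l.
pose d : 'rV[R]_n * 'rV[R]_p := (\row_i q' (e1 i), \row_j q' (e2 j)).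
have q'd v : q' v <= pdot d v.
  have vE : v = \sum_i v.1 0 i *: e1 i + \sum_j v.2 0 j *: e2 j.
    case: v => v1 v2 /=; rewrite {1}(row_sum_delta v1) {1}(row_sum_delta v2).
    apply/eqP; rewrite xpair_eqE; apply/andP; split; apply/eqP.
      rewrite [RHS]/= !raddf_sum /= [X in _ + X]big1 ?addr0// => j _.
      by rewrite scaler0.
    rewrite [RHS]/= !raddf_sum /= [X in X + _]big1 ?add0r// => j _.
    by rewrite scaler0.
  rewrite {1}vE (le_trans (q's.1 _ _))// /pdot !dotvE lerD//.
    rewrite (le_trans (q'sum _ _))// ler_sum// => i _.
    by rewrite q'Z// mxE mulrC.
  rewrite (le_trans (q'sum _ _))// ler_sum// => j _.
  by rewrite q'Z// mxE mulrC.
exists d => v; rewrite (le_trans _ (q'q v))//.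
have := q'd (- v); have := sublinear_oppr v q's.
have -> : pdot d (- v) = - pdot d v by rewrite /pdot /= !dotvNr -opprD.
lra.
Qed.
End hahn_banach.

(** * Clarke directional derivatives of Lipschitz functions *)

Section clarke.
Set Implicit Arguments.
Unset Strict Implicit.
Context {R : realType} {n p : nat}.
Local Notation E := ('rV[R]_n * 'rV[R]_p)%type.
Implicit Types (F : E -> R) (z v w : E).

(** The limsup in epsilon-delta form with the division cleared, so that increment estimates apply in
    real arithmetic. *)
Lemma clarke_dd_leP F z v (r : R) : (clarke_dd F z v <= r%:E)%E <->
  forall e, 0 < e -> exists2 d, 0 < d & forall z' t,
    pnorm (z' - z) < d -> 0 < t < d -> F (z' + t *: v) - F z' <= t * (r + e).
Proof.
split=> [Fr e e0|Fr].
  have : (clarke_dd F z v < (r + e)%:E)%E.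
    by rewrite (le_lt_trans Fr)// lte_fin ltrDl.
  move=> /ereal_inf_lt[_ [d /= d0 <-]] supd; exists d => // z' t z'd td.
  have t0 : 0 < t by case/andP: td.
  rewrite mulrC -ler_pdivrMr// -lee_fin (le_trans _ (ltW supd))//.
  by apply: ereal_sup_ubound; exists z' => //; exists t.
apply/lee_addgt0Pr => e /Fr[d d0 Fd].
apply: ge_ereal_inf; exists (ereal_sup
  [set ((F (z' + t *: v) - F z') / t)%:E
    | z' in [set z' | pnorm (z' - z) < d] & t in [set t : R | 0 < t < d]]).
  by exists d.
apply: ge_ereal_sup => _ [z' z'd [t td <-]].
have t0 : 0 < t by case/andP: td.
by rewrite -EFinD lee_fin ler_pdivrMr// mulrC; exact: Fd.
Qed.

Lemma exists_small (K d : R) : 0 <= K -> 0 < d ->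
  exists e, [/\ 0 < e, e <= 1 & (1 + K) * e <= d].
Proof.
move=> K0 d0; have K1 : 0 < 1 + K by lra.
exists (Num.min 1 (d / (1 + K))); split.
- by rewrite lt_min ltr01 divr_gt0.
- by rewrite ge_min lexx.
- by rewrite mulrC -ler_pdivlMr// ge_min lexx orbT.
Qed.

Section lipschitz.
Variables (F : E -> R) (M : R).
Hypothesis F_lip : forall z z', `|F z - F z'| <= M * pnorm (z - z').

Lemma clarke_dd_le_lipschitz z v : (clarke_dd F z v <= (M * pnorm v)%:E)%E.
Proof.
apply/clarke_dd_leP => e e0; exists 1 => // z' t _ /andP[t0 _].
rewrite (le_trans (ler_norm _))// (le_trans (F_lip _ _))//.
rewrite addrAC subrr add0r pnormZ gtr0_norm// mulrCA ler_pM2l//; lra.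
Qed.

Lemma clarke_dd_ge_lipschitz z v (r : R) :
  (clarke_dd F z v <= r%:E)%E -> - (M * pnorm v) <= r.
Proof.
move=> /clarke_dd_leP Fr; apply/ler_addgt0Pr => e /Fr[d d0 /(_ z (d / 2))].
rewrite subrr pnorm0 => /(_ d0) Fd.
have d20 : 0 < d / 2 by rewrite divr_gt0.
rewrite -(@ler_pM2l _ (d / 2))// (le_trans _ (Fd _))//; last first.
  by rewrite d20 /=; lra.
have := F_lip (z + (d / 2) *: v) z.
rewrite ler_norml addrAC subrr add0r pnormZ (gtr0_norm d20).
by rewrite mulrN mulrCA => /andP[].
Qed.

Lemma clarke_dd_fineK z v : ((fine (clarke_dd F z v))%:E = clarke_dd F z v)%E.
Proof.
apply: fineK; rewrite fin_numE; apply/andP; split; apply/eqP => Foo.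
  have := @clarke_dd_ge_lipschitz z v (- (M * pnorm v) - 1).
  by rewrite Foo leNye => /(_ isT); lra.
by have := clarke_dd_le_lipschitz z v; rewrite Foo.
Qed.

Lemma sublinear_clarke_dd z : sublinear (fun v => fine (clarke_dd F z v)).
Proof.
have dd_le v r : fine (clarke_dd F z v) <= r <-> (clarke_dd F z v <= r%:E)%E.
  by rewrite -lee_fin clarke_dd_fineK.
have ddP v : forall e, 0 < e -> exists2 d, 0 < d & forall z' t,
    pnorm (z' - z) < d -> 0 < t < d ->
    F (z' + t *: v) - F z' <= t * (fine (clarke_dd F z v) + e).
  by apply/clarke_dd_leP; rewrite clarke_dd_fineK.
(* One inequality suffices: its instance for [a^-1] and [a *: v] is the converse. *)
have ddZ_le a v : 0 < a ->
    fine (clarke_dd F z (a *: v)) <= a * fine (clarke_dd F z v).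
  move=> a0; apply/dd_le/clarke_dd_leP => e e0.
  have [d d0 Fd] := ddP v _ (divr_gt0 e0 a0).
  have [d' [d'0 _ d'd]] := exists_small (ltW a0) d0.
  exists d' => // z' t z'd' /andP[t0 td'].
  have tad : 0 < t * a < d by rewrite mulr_gt0//=; nra.
  have z'd : pnorm (z' - z) < d by nra.
  have := Fd z' (t * a) z'd tad; rewrite scalerA -mulrA mulrDr.
  by rewrite mulrCA divff ?gt_eqF// mulr1.
split=> [u v|a v].
  apply/dd_le/clarke_dd_leP => e e0; have e20 : 0 < e / 2 by rewrite divr_gt0.
  have [d1 d10 Fd1] := ddP u _ e20.
  have [d2 d20 Fd2] := ddP v _ e20.
  have [d [d0 _ dd2]] := exists_small (pnorm_ge0 u) d20.
  exists (Num.min d1 d) => [|z' t]; first by rewrite lt_min d10.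
  rewrite !lt_min => /andP[z'd1 z'd] /and3P[t0 td1 td].
  have := Fd1 z' t z'd1; rewrite t0 td1 => /(_ isT).
  have u0 := pnorm_ge0 u.
  (* The increment along [u + v] is split at [z' + t *: u], which must still be close to [z] to
     serve as base point of the second piece. *)
  have z'u : pnorm (z' + t *: u - z) < d2.
    rewrite addrAC (le_lt_trans (ler_pnormD _ _))// pnormZ (gtr0_norm t0); nra.
  have := Fd2 _ t z'u; rewrite t0 scalerDr addrA.
  have -> : t < d2 by nra.
  by move=> /(_ isT); lra.
rewrite le_eqVlt => /predU1P[<-|a0].
  rewrite scale0r mul0r; apply/eqP; rewrite eq_le; apply/andP; split.
    by apply/dd_le; have := clarke_dd_le_lipschitz z 0; rewrite pnorm0 mulr0.
  have := @clarke_dd_ge_lipschitz z 0 (fine (clarke_dd F z 0)).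
  by rewrite clarke_dd_fineK pnorm0 mulr0 oppr0; apply.
apply/eqP; rewrite eq_le ddZ_le//= -ler_pdivlMl//.
have ai0 : 0 < a^-1 by rewrite invr_gt0.
have := ddZ_le _ (a *: v) ai0.
by rewrite scalerA mulVf ?gt_eqF// scale1r.
Qed.

Lemma clarke_subdiff_fineP z d :
  clarke_subdiff F z d <-> forall v, pdot d v <= fine (clarke_dd F z v).
Proof.
by split=> dF v; have := dF v; rewrite -lee_fin clarke_dd_fineK.
Qed.

(* A calculus-free chain rule: [w] plays the role of the derivative of [zeta]
   at [z] along [v] up to the slope error [a], [b] that of the derivative
   of [k]. *)
Lemma clarke_dd_comp_le (H k : E -> R) (zeta : E -> E) z v w (a b K1 K2 K3 r : R) :
    0 <= M -> 0 <= K1 -> 0 <= K2 -> 0 <= K3 ->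
    (forall z', H z' = F (zeta z') + k z') ->
    (forall d z', d <= 1 -> pnorm (z' - z) < d ->
      pnorm (zeta z' - zeta z) <= K1 * d) ->
    (forall d z' t, d <= 1 -> pnorm (z' - z) < d -> 0 < t < d ->
      pnorm (zeta (z' + t *: v) - (zeta z' + t *: w)) <= t * (a + K2 * d)) ->
    (forall d z' t, d <= 1 -> pnorm (z' - z) < d -> 0 < t < d ->
      k (z' + t *: v) - k z' <= t * (b + K3 * d)) ->
  (clarke_dd F (zeta z) w <= r%:E)%E ->
  (clarke_dd H z v <= (r + M * a + b)%:E)%E.
Proof.
move=> M0 K10 K20 K30 HE zeta_cont zeta_diff k_diff /clarke_dd_leP Fr.
apply/clarke_dd_leP => e e0; have e20 : 0 < e / 2 by rewrite divr_gt0.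
have [d1 d10 Fd1] := Fr _ e20.
have [d2 [d20 d21 d2d1]] := exists_small K10 d10.
have MK0 : 0 <= M * K2 + K3 by rewrite addr_ge0// mulr_ge0.
have [d3 [d30 d31 d3e]] := exists_small MK0 e20.
exists (Num.min d2 d3) => [|z' t]; first by rewrite lt_min d20.
set d := Num.min d2 d3 => z'd td; have /andP[t0 td'] := td.
have dd2 : d <= d2 by rewrite ge_min lexx.
have dd3 : d <= d3 by rewrite ge_min lexx orbT.
have d1' : d <= 1 by rewrite (le_trans dd2).
have z'z : pnorm (zeta z' - zeta z) < d1.
  by rewrite (le_lt_trans (zeta_cont _ _ d1' z'd))//; nra.
have td1 : 0 < t < d1 by rewrite t0 /=; nra.
have F1 := Fd1 _ _ z'z td1.
have k1 := k_diff _ _ _ d1' z'd td.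
(* Replacing the endpoint by its linearization [zeta z' + t *: w] costs [M] times their distance. *)
have := le_trans (ler_norm _) (F_lip (zeta (z' + t *: v)) (zeta z' + t *: w)).
move=> /le_trans /(_ (ler_wpM2l M0 (zeta_diff _ _ _ d1' z'd td))) F2.
have Kd : (M * K2 + K3) * d <= e / 2 by nra.
rewrite !HE; have : t * ((M * K2 + K3) * d) <= t * (e / 2) by rewrite ler_pM2l.
rewrite (_ : M * _ = t * (M * (a + K2 * d))) in F2; last by ring.
lra.
Qed.

End lipschitz.

End clarke.

(** * Mean value theorems along segments *)

Section mean_value.
Set Implicit Arguments.
Unset Strict Implicit.
Context {R : realType}.

Lemma is_derive_line (V W : normedModType R) (F : V -> W) (z v : V) (t : R) :
  differentiable F (z + t *: v) ->
  is_derive t 1 (fun s => F (z + s *: v)) ('d F (z + t *: v) v).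
Proof.
move=> Fd; have := @diff_derivable _ _ _ _ _ v Fd; rewrite -deriveE// => Fv.
have E : (fun h => h^-1 *: (((fun s => F (z + s *: v)) \o shift t) (h *: (1 : R^o))
      - F (z + t *: v))) =
    (fun h => h^-1 *: ((F \o shift (z + t *: v)) (h *: v) - F (z + t *: v))).
  apply/funext => h /=; do 3 f_equal.
  by rewrite -[h *: 1]/(h * 1) mulr1 scalerDl addrCA.
by apply: DeriveDef; rewrite /derivable /derive E.
Qed.

Lemma MVT_line (F dF : R -> R) (t : R) : 0 < t ->
  (forall s : R, is_derive s 1 F (dF s)) ->
  exists2 s, 0 < s < t & F t - F 0 = t * dF s.
Proof.
move=> t0 FdF.
have Fcont : {within `[0, t], continuous F}.
  by apply: derivable_within_continuous => s _; exact: ex_derive.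
have [s] := MVT t0 (fun s _ => FdF s) Fcont.
by rewrite in_itv /= subr0 mulrC => st ->; exists s.
Qed.

(** A mean value equality fails in general for vector values; pairing with a fixed [w] makes the
    function scalar, and [s] then depends on [w]. *)
Lemma MVT_dotv (V : normedModType R) k (F : V -> 'rV[R]_k) (z v : V) w (t : R) :
  (forall z, differentiable F z) -> 0 < t ->
  exists2 s, 0 < s < t &
    dotv (F (z + t *: v) - F z) w = t * dotv ('d F (z + s *: v) v) w.
Proof.
move=> Fd t0.
have line (s : R) i : is_derive s 1 (fun s : R => F (z + s *: v) 0 i)
    (('d F (z + s *: v) v) 0 i).
  have FL := is_derive_line (Fd (z + s *: v)).
  have FLd : derivable (fun s : R => F (z + s *: v)) s 1 by exact: ex_derive.
  apply: DeriveDef; first by move/derivable_mxP : FLd; exact.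
  by rewrite -(@derive_val _ _ _ _ _ _ _ FL) derive_mx// mxE.
have dline (s : R) : is_derive s 1 (fun s : R => \sum_i F (z + s *: v) 0 i * w 0 i)
    (\sum_i ('d F (z + s *: v) v) 0 i * w 0 i).
  have := is_derive_sum (fun i => @is_deriveZ _ _ _ _ (w 0 i) _ _ _ (line s i)).
  rewrite (_ : \sum_i _ = fun s => \sum_i F (z + s *: v) 0 i * w 0 i).
    rewrite (_ : \sum_i _ = \sum_i ('d F (z + s *: v) v) 0 i * w 0 i)//.
    by apply: eq_bigr => i _; rewrite mulrC.
  apply/funext => x; rewrite fct_sumE; apply: eq_bigr => i _.
  by rewrite mulrC.
have [s st] := MVT_line t0 dline; rewrite scale0r addr0 -!dotvE -dotvBl => ->.
by exists s.
Qed.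

End mean_value.

(** * Symmetry of the Hessian block [Hyy] *)

Section hessian.
Set Implicit Arguments.
Unset Strict Implicit.
Context {R : realType} {n p : nat}.
Local Notation E := ('rV[R]_n * 'rV[R]_p)%type.
Variables (g : E -> R) (gx : E -> 'rV[R]_n) (gy : E -> 'rV[R]_p).
Variables (Hxy : E -> 'M[R]_(n, p)) (Hyy : E -> 'M[R]_p) (Qg : R).
Hypothesis g_diff : forall z, differentiable g z.
Hypothesis g_grad : forall z u, 'd g z u = dotv (gx z) u.1 + dotv (gy z) u.2.
Hypothesis gy_diff : forall z, differentiable gy z.
Hypothesis gy_hess : forall z u, 'd gy z u = u.1 *m Hxy z + u.2 *m Hyy z.
Hypothesis Hyy_lip : forall z z' (v : 'rV[R]_p),
  enorm (v *m (Hyy z - Hyy z')) <= Qg * pnorm (z - z') * enorm v.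
Hypothesis Qg_ge0 : 0 <= Qg.

Let inr (u : 'rV[R]_p) : E := (0, u).

(** Two mean value steps, along [u] for the difference of [g] in direction [v], then along [v] for
    [gy], turn the second difference into [Hyy] at a nearby point; [Hyy_lip] brings it back to
    [z]. *)
Lemma second_difference_bound z u v (s : R) : 0 < s ->
  `|g (z + s *: inr u + s *: inr v) - g (z + s *: inr u) - g (z + s *: inr v) + g z
    - s ^+ 2 * dotv (v *m Hyy z) u|
  <= s ^+ 2 * (s * (Qg * (enorm u + enorm v) * enorm v * enorm u)).
Proof.
move=> s0; have s2 : 0 < s ^+ 2 by rewrite exprn_gt0.
pose psi (r : R) := g (z + s *: inr v + r *: inr u) - g (z + r *: inr u).
have dpsi (r : R) : is_derive r 1 psi
    (dotv (gy (z + s *: inr v + r *: inr u)) u - dotv (gy (z + r *: inr u)) u).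
  have dg z' (r' : R) : is_derive r' 1 (fun t : R => g (z' + t *: inr u))
      (dotv (gy (z' + r' *: inr u)) u).
    apply: is_derive_eq; first exact: is_derive_line.
    by rewrite g_grad dotv0r add0r.
  exact: is_deriveB.
have [r /andP[r0 rs]] := MVT_line s0 dpsi.
have [q /andP[q0 qs]] := MVT_dotv (z + r *: inr u) (inr v) u gy_diff s0.
rewrite gy_hess /= mul0mx add0r -dotvBl (addrAC z) => -> psiE.
have -> : g (z + s *: inr u + s *: inr v) - g (z + s *: inr u)
    - g (z + s *: inr v) + g z = s ^+ 2 * dotv (v *m Hyy (z + r *: inr u + q *: inr v)) u.
  by rewrite expr2 -mulrA -psiE /psi scale0r !addr0 (addrAC z); ring.
rewrite -mulrBr normrM (gtr0_norm s2) ler_pM2l// -dotvBl -mulmxBr.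
set D := Hyy _ - Hyy _.
have D_le : enorm (v *m D) <= s * (Qg * (enorm u + enorm v) * enorm v).
  have -> : s * (Qg * (enorm u + enorm v) * enorm v) =
    Qg * (s * (enorm u + enorm v)) * enorm v by ring.
  rewrite (le_trans (Hyy_lip _ _ _))// ler_wpM2r ?enorm_ge0// ler_wpM2l//.
  rewrite [X in pnorm X]addrC !addrA addNr add0r (le_trans (ler_pnormD _ _))//.
  rewrite !pnormZ !gtr0_norm// !pnorm_inr mulrDr.
  by rewrite lerD// ler_wpM2r ?enorm_ge0// ltW.
rewrite mulrA ler_norml; apply/andP; split.
  rewrite lerNl -dotvNl (le_trans (dotv_le_enorm _ _))// enormN.
  by rewrite ler_wpM2r ?enorm_ge0.
by rewrite (le_trans (dotv_le_enorm _ _))// ler_wpM2r ?enorm_ge0.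
Qed.

(** The second difference is symmetric in [u] and [v], so after division by [s ^+ 2] the two
    bilinear forms differ by at most twice an error of order [s]. *)
Lemma hessian_sym z : (Hyy z)^T = Hyy z.
Proof.
have sym u v : dotv (v *m Hyy z) u <= dotv (u *m Hyy z) v.
  pose C := Qg * (enorm u + enorm v) * enorm v * enorm u.
  have C0 : 0 <= C by rewrite !mulr_ge0 ?addr_ge0 ?enorm_ge0.
  apply/ler_addgt0Pr => e e0.
  have [s [s0 _ sC]] := exists_small (mulr_ge0 (ler0n _ 2) C0) e0.
  have s2 : 0 < s ^+ 2 by rewrite exprn_gt0.
  have := second_difference_bound z v u s0.
  have := second_difference_bound z u v s0.
  rewrite -(addrA z) (addrC (s *: inr u)) addrA.
  set G := g _; set Gu := g _; set Gv := g _.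
  rewrite !ler_norml => /andP[uv _] /andP[_ vu].
  rewrite -(@ler_pM2l _ (s ^+ 2))// mulrDr.
  have sCe : s ^+ 2 * (2 * (s * C)) <= s ^+ 2 * e by rewrite ler_pM2l//; nra.
  have CE : Qg * (enorm v + enorm u) * enorm u * enorm v = C by rewrite /C; ring.
  by rewrite CE -/C in uv vu; lra.
have sym_eq u v : dotv (v *m Hyy z) u = dotv (u *m Hyy z) v.
  by apply/eqP; rewrite eq_le !sym.
apply/matrixP => i j; rewrite mxE.
have := sym_eq (delta_mx 0 i) (delta_mx 0 j).
by rewrite /dotv -!rowE !trmx_delta -!colE !mxE.
Qed.

End hessian.

(** * Inverses of coercive matrices *)

Section coercive.
Set Implicit Arguments.
Unset Strict Implicit.
Context {R : realType} {p : nat}.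
Variables (mu : R) (M : 'M[R]_p).
Hypothesis mu_gt0 : 0 < mu.
Hypothesis M_pd : forall v, mu * dotv v v <= dotv (v *m M) v.

Lemma coercive_unitmx : M \in unitmx.
Proof.
rewrite -row_free_unit -kermx_eq0; apply/rowV0P => v /sub_kermxP vM.
apply: dotv_eq0; apply/eqP; rewrite eq_le dotv_ge0 andbT.
by have := M_pd v; rewrite vM dotv0l pmulr_rle0.
Qed.

(** Coercivity at [w = v *m invmx M] and Cauchy-Schwarz give
    [mu * enorm w ^+ 2 <= enorm v * enorm w]. *)
Lemma enorm_mul_invmx (v : 'rV[R]_p) : enorm (v *m invmx M) <= mu^-1 * enorm v.
Proof.
have v0 : 0 <= mu^-1 * enorm v by rewrite mulr_ge0 ?enorm_ge0 ?invr_ge0 ?ltW.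
have [->//|wn0] := eqVneq (enorm (v *m invmx M)) 0.
have w0 : 0 < enorm (v *m invmx M) by rewrite lt_def wn0 enorm_ge0.
rewrite ler_pdivlMl// -(ler_pM2r w0) -mulrA -expr2 enorm_sqr.
by rewrite (le_trans (M_pd _))// mulmxKV ?coercive_unitmx// dotv_le_enorm.
Qed.

End coercive.

(** * Increments of the gradient, the Newton map and the penalty *)

Section newton.
Set Implicit Arguments.
Unset Strict Implicit.
Context {R : realType} {n p : nat}.
Local Notation E := ('rV[R]_n * 'rV[R]_p)%type.
Variables (gy : E -> 'rV[R]_p) (Hxy : E -> 'M[R]_(n, p)) (Hyy : E -> 'M[R]_p).
Variables (mu Lg Qg : R).
Hypothesis (mu_gt0 : 0 < mu) (Lg_ge0 : 0 <= Lg) (Qg_ge0 : 0 <= Qg).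
Hypothesis gy_diff : forall z, differentiable gy z.
Hypothesis gy_hess : forall z u, 'd gy z u = u.1 *m Hxy z + u.2 *m Hyy z.
Hypothesis gy_lip : forall z z', enorm (gy z - gy z') <= Lg * pnorm (z - z').
Hypothesis Hyy_pd : forall z v, mu * dotv v v <= dotv (v *m Hyy z) v.
Hypothesis Hyy_lip : forall z z' (v : 'rV[R]_p),
  enorm (v *m (Hyy z - Hyy z')) <= Qg * pnorm (z - z') * enorm v.
Hypothesis Hxy_lip : forall z z' (v : 'rV[R]_p),
  enorm ((Hxy z - Hxy z') *m v^T)^T <= Qg * pnorm (z - z') * enorm v.

Let mi_ge0 : 0 <= mu^-1. Proof. by rewrite invr_ge0 ltW. Qed.

(** Resolvent identity [X^-1 - Y^-1 = - X^-1 (X - Y) Y^-1]; each inverse contributes a factor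
    [mu^-1]. *)
Lemma enorm_invmxB z z' (v : 'rV[R]_p) :
  enorm (v *m (invmx (Hyy z) - invmx (Hyy z'))) <=
  mu^-1 ^+ 2 * Qg * pnorm (z - z') * enorm v.
Proof.
have Hu x := coercive_unitmx mu_gt0 (Hyy_pd x).
have -> : v *m (invmx (Hyy z) - invmx (Hyy z')) =
    - (v *m invmx (Hyy z) *m (Hyy z - Hyy z') *m invmx (Hyy z')).
  rewrite !mulmxBr !mulmxBl mulmxKV//.
  by rewrite -(mulmxA _ (Hyy z')) mulmxV// mulmx1 opprB.
rewrite enormN (le_trans (enorm_mul_invmx mu_gt0 (Hyy_pd _) _))//.
rewrite expr2 -!mulrA ler_wpM2l// (le_trans (Hyy_lip _ _ _))//.
rewrite mulrCA -mulrA ler_wpM2l// mulrCA ler_wpM2l ?pnorm_ge0//.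
exact: enorm_mul_invmx mu_gt0 (Hyy_pd _) _.
Qed.

Definition dgy z (v : E) : 'rV[R]_p := v.1 *m Hxy z + v.2 *m Hyy z.

(** The derivative is frozen at [z] while the base point [z'] moves, as the Clarke limsup requires;
    [r] measures how far the segment strays from [z]. *)
Lemma gy_taylor z z' v (t r : R) : 0 < t -> 0 <= r ->
    (forall s, 0 < s < t -> pnorm (z' + s *: v - z) <= r) ->
  enorm (gy (z' + t *: v) - gy z' - t *: dgy z v) <=
  t * (Qg * r * (enorm v.1 + enorm v.2)).
Proof.
move=> t0 r0 seg; apply: enorm_le_dual => [|w].
  by rewrite !mulr_ge0 ?addr_ge0 ?enorm_ge0// ltW.
have [s st] := MVT_dotv z' v w gy_diff t0.
move=> mvtE; rewrite dotvBl mvtE dotvZl -mulrBr -mulrA ler_pM2l//.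
have {}seg := seg _ st; set zs := z' + s *: v in seg *.
have Qr : Qg * pnorm (zs - z) <= Qg * r by rewrite ler_wpM2l.
(* The [Hxy] difference is moved onto [w], since [Hxy_lip] bounds its action on columns. *)
rewrite gy_hess -dotvBl /dgy opprD addrACA -!mulmxBr dotvDl dotv_mulmx.
have w0 := enorm_ge0 w; have v10 := enorm_ge0 v.1; have v20 := enorm_ge0 v.2.
have -> : Qg * r * (enorm v.1 + enorm v.2) * enorm w =
  enorm v.1 * (Qg * r * enorm w) + Qg * r * enorm v.2 * enorm w by ring.
rewrite lerD//; rewrite (le_trans (dotv_le_enorm _ _))//.
  by rewrite ler_wpM2l// (le_trans (Hxy_lip _ _ _))// ler_wpM2r.
by rewrite ler_wpM2r// (le_trans (Hyy_lip _ _ _))// ler_wpM2r.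
Qed.

(* The pair [(x, A (x, y))]. *)
Definition newton z : E := (z.1, z.2 - gy z *m invmx (Hyy z)).

(** The variation of [Hyy^-1] acts on [gy z], which puts [enorm (gy z)] into the constant; the 2
    adds the displacements of both components. *)
Lemma newton_lip_at z d z' : pnorm (z' - z) < d ->
  pnorm (newton z' - newton z) <=
  (2 + (mu^-1 * Lg + mu^-1 ^+ 2 * Qg * enorm (gy z))) * d.
Proof.
move=> z'd; have d0 : 0 <= d by rewrite ltW// (le_lt_trans (pnorm_ge0 _) z'd).
have sndE : (newton z' - newton z).2 = (z' - z).2 -
    ((gy z' - gy z) *m invmx (Hyy z') + gy z *m (invmx (Hyy z') - invmx (Hyy z))).
  rewrite /= mulmxBl mulmxBr addrA subrK !opprD !opprK.
  by rewrite -!addrA; congr (_ + _); rewrite addrCA.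
have h1 : enorm (newton z' - newton z).1 <= d.
  by rewrite (le_trans _ (ltW z'd))// (enorm_fst_le_pnorm (z' - z)).
have h2 : enorm (z' - z).2 <= d.
  by rewrite (le_trans _ (ltW z'd))// (enorm_snd_le_pnorm (z' - z)).
have h3 : enorm ((gy z' - gy z) *m invmx (Hyy z')) <= mu^-1 * (Lg * d).
  rewrite (le_trans (enorm_mul_invmx mu_gt0 (Hyy_pd _) _))// ler_wpM2l//.
  by rewrite (le_trans (gy_lip _ _))// ler_wpM2l// ltW.
have h4 : enorm (gy z *m (invmx (Hyy z') - invmx (Hyy z))) <=
    mu^-1 ^+ 2 * Qg * d * enorm (gy z).
  rewrite (le_trans (enorm_invmxB _ _ _))// ler_wpM2r ?enorm_ge0// ler_wpM2l//.
    by rewrite mulr_ge0 ?exprn_ge0.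
  exact: ltW.
have := pnorm_le_enormD (newton z' - newton z); rewrite sndE.
have := ler_enormB (z' - z).2 ((gy z' - gy z) *m invmx (Hyy z') +
  gy z *m (invmx (Hyy z') - invmx (Hyy z))).
have := ler_enormD ((gy z' - gy z) *m invmx (Hyy z'))
  (gy z *m (invmx (Hyy z') - invmx (Hyy z))).
lra.
Qed.

Section at_point.
Variables (z v : E).
Let N := pnorm v.
Let s := enorm v.1 + enorm v.2.
Let N_ge0 : 0 <= N. Proof. exact: pnorm_ge0. Qed.
Let s_ge0 : 0 <= s. Proof. by rewrite addr_ge0 ?enorm_ge0. Qed.

Lemma pnorm_segment d z' (t : R) : pnorm (z' - z) < d -> 0 < t < d ->
  pnorm (z' + t *: v - z) <= (1 + N) * d.
Proof.
move=> z'd /andP[t0 td]; rewrite addrAC (le_trans (ler_pnormD _ _))//.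
by rewrite pnormZ (gtr0_norm t0) mulrDl mul1r lerD ?(ltW z'd)// mulrC ler_wpM2l// ltW.
Qed.

Lemma enorm_gy_near d z' : pnorm (z' - z) <= d ->
  enorm (gy z') <= enorm (gy z) + Lg * d.
Proof.
move=> z'd; rewrite -[gy z'](subrKC (gy z)) (le_trans (ler_enormD _ _))// lerD2l.
by rewrite (le_trans (gy_lip _ _))// ler_wpM2l.
Qed.

Lemma gy_increment d z' t : pnorm (z' - z) < d -> 0 < t < d ->
  enorm (gy (z' + t *: v) - gy z' - t *: dgy z v) <=
  t * (Qg * ((1 + N) * d) * s).
Proof.
move=> z'd td; have /andP[t0 td'] := td.
apply: gy_taylor => // [|q /andP[q0 qt]].
  by rewrite mulr_ge0 ?addr_ge0// ltW// (lt_trans t0).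
by apply: pnorm_segment; rewrite ?q0// (lt_trans qt).
Qed.

(** The errors are the Taylor remainder of [gy] and the variations of [Hyy^-1] acting on
    [t *: dgy z v] and on [gy z']. Only the last leaves a first-order term, as the derivative of
    [Hyy^-1] is bounded rather than computed; this term carries the factor [enorm (gy z)]. *)
Lemma newton_increment d z' t : pnorm (z' - z) < d -> 0 < t < d ->
  pnorm (newton (z' + t *: v) -
    (newton z' + t *: (v.1, v.2 - dgy z v *m invmx (Hyy z)))) <=
  t * (mu^-1 ^+ 2 * Qg * N * enorm (gy z) +
    (mu^-1 * (Qg * (1 + N) * s) + mu^-1 ^+ 2 * Qg * (1 + N) * enorm (dgy z v)
      + mu^-1 ^+ 2 * Qg * N * Lg) * d).
Proof.
move=> z'd td; have /andP[t0 td'] := td.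
have d0 : 0 <= d by rewrite ltW// (lt_trans t0).
set W := z' + t *: v; set G := dgy z v.
set D := newton W - _.
have -> : D = (0, (t *: G - (gy W - gy z')) *m invmx (Hyy W)
    + t *: G *m (invmx (Hyy z) - invmx (Hyy W))
    + gy z' *m (invmx (Hyy z') - invmx (Hyy W))).
  rewrite /D /newton /W; apply/eqP; rewrite xpair_eqE /= subrr eqxx /=; apply/eqP.
  rewrite -/W -/G !mulmxBl !mulmxBr !scalerBr -!scalemxAl.
  move: (gy W *m _) (gy z' *m _) (gy z' *m _) (G *m _) (G *m _) => a1 a2 a3 a4 a5.
  by apply/rowP => j; rewrite !mxE; ring.
rewrite pnorm_inr.
have h1 : enorm ((t *: G - (gy W - gy z')) *m invmx (Hyy W)) <=
    mu^-1 * (t * (Qg * ((1 + N) * d) * s)).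
  rewrite (le_trans (enorm_mul_invmx mu_gt0 (Hyy_pd _) _))// ler_wpM2l//.
  by rewrite -enormN opprB; exact: gy_increment.
have h2 : enorm (t *: G *m (invmx (Hyy z) - invmx (Hyy W))) <=
    mu^-1 ^+ 2 * Qg * ((1 + N) * d) * (t * enorm G).
  rewrite (le_trans (enorm_invmxB _ _ _))// enormZ (gtr0_norm t0).
  rewrite ler_wpM2r ?mulr_ge0 ?enorm_ge0 ?(ltW t0)// ler_wpM2l//.
    by rewrite mulr_ge0 ?exprn_ge0.
  by rewrite -pnormN opprB; exact: pnorm_segment.
have h3 : enorm (gy z' *m (invmx (Hyy z') - invmx (Hyy W))) <=
    mu^-1 ^+ 2 * Qg * (t * N) * (enorm (gy z) + Lg * d).
  rewrite (le_trans (enorm_invmxB _ _ _))// /W opprD addNKr pnormN pnormZ.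
  rewrite (gtr0_norm t0) ler_wpM2l//.
    by rewrite !mulr_ge0 ?exprn_ge0// ltW.
  exact/enorm_gy_near/ltW.
rewrite (le_trans (ler_enormD _ _))// (le_trans (lerD (ler_enormD _ _) h3))//.
by rewrite (le_trans (lerD (lerD h1 h2) (lexx _)))//; lra.
Qed.

(** A difference of squares is the product of difference and sum: the difference is [t *: dgy z v]
    to first order, and the sum is close to [2 *: gy z]. *)
Lemma gy_sqr_increment d z' t : d <= 1 -> pnorm (z' - z) < d -> 0 < t < d ->
  enorm (gy (z' + t *: v)) ^+ 2 - enorm (gy z') ^+ 2 <=
  t * (2 * dotv (dgy z v) (gy z) +
    (Qg * (1 + N) * s * (2 * enorm (gy z) + Lg * (2 + N))
      + enorm (dgy z v) * (Lg * (2 + N))) * d).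
Proof.
move=> d1 z'd td; have /andP[t0 td'] := td.
have d0 : 0 <= d by rewrite ltW// (lt_trans t0).
have Wd := pnorm_segment z'd td.
set W := z' + t *: v in Wd *; set G := dgy z v.
have inc := gy_increment z'd td.
rewrite -/W -/G in inc; clearbody G.
have c_le := enorm_gy_near (ltW z'd); have cW_le := enorm_gy_near Wd.
have := enorm_ge0 (gy z); have := enorm_ge0 G => G0 a0.
have -> : enorm (gy W) ^+ 2 - enorm (gy z') ^+ 2 =
    dotv (gy W - gy z' - t *: G) (gy W + gy z')
    + t * dotv G (gy W - gy z + (gy z' - gy z)) + t * (2 * dotv G (gy z)).
  rewrite !enorm_sqr !(dotvDl, dotvDr, dotvNl, dotvNr, dotvZl).
  by rewrite (dotvC (gy z') (gy W)); ring.
have h1 : dotv (gy W - gy z' - t *: G) (gy W + gy z') <=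
    t * (Qg * ((1 + N) * d) * s) * (2 * enorm (gy z) + Lg * (2 + N)).
  rewrite (le_trans (dotv_le_enorm _ _))// ler_pM ?enorm_ge0//.
  rewrite (le_trans (ler_enormD _ _))//.
  (* Here [d <= 1] bounds the second factor by a constant, keeping the product linear in [d]. *)
  have : Lg * ((1 + N) * d) + Lg * d <= Lg * (2 + N).
    have dN : 0 <= (2 + N) * (1 - d) by rewrite mulr_ge0 ?subr_ge0 ?addr_ge0.
    by rewrite -mulrDr ler_wpM2l//; lra.
  by lra.
have h2 : dotv G (gy W - gy z + (gy z' - gy z)) <= enorm G * (Lg * (2 + N) * d).
  rewrite (le_trans (dotv_le_enorm _ _))// ler_wpM2l//.
  rewrite (le_trans (ler_enormD _ _))//.
  have := le_trans (gy_lip W z) (ler_wpM2l Lg_ge0 Wd).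
  have := le_trans (gy_lip z' z) (ler_wpM2l Lg_ge0 (ltW z'd)).
  by lra.
have := ler_wpM2l (ltW t0) h2.
by lra.
Qed.

End at_point.
(* To first order [newton] does not see the motion of [y], hence the weight
   [pnorm v * enorm (gy z)] of its error against the slope of the penalty. *)
Lemma clarke_dd_penalty_le (f : E -> R) (Mf beta : R) (z v : E) (r : R) :
    0 <= Mf -> 0 <= beta ->
    (forall z z', `|f z - f z'| <= Mf * pnorm (z - z')) ->
  (clarke_dd f (newton z)
    (v.1, (v.2 - dgy z v *m invmx (Hyy z))%R) <= r%:E)%E ->
  (clarke_dd (fun z' => f (newton z') + beta / 2 * enorm (gy z') ^+ 2)%R z v <=
    (r + Mf * (mu^-1 ^+ 2 * Qg * pnorm v * enorm (gy z))
      + beta * dotv (dgy z v) (gy z))%:E)%E.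
Proof.
move=> Mf0 beta0 f_lip fr.
have N0 := pnorm_ge0 v; have a0 := enorm_ge0 (gy z).
have G0 := enorm_ge0 (dgy z v).
have s0 : 0 <= enorm v.1 + enorm v.2 by rewrite addr_ge0 ?enorm_ge0.
have N1 : 0 <= 1 + pnorm v by rewrite addr_ge0.
have N2 : 0 <= 2 + pnorm v by rewrite addr_ge0.
pose K3 := beta / 2 *
  (Qg * (1 + pnorm v) * (enorm v.1 + enorm v.2) *
    (2 * enorm (gy z) + Lg * (2 + pnorm v))
   + enorm (dgy z v) * (Lg * (2 + pnorm v))).
apply: (clarke_dd_comp_le (K3 := K3) f_lip Mf0 _ _ _ (fun=> erefl)
  (fun d z' _ => @newton_lip_at z d z')
  (fun d z' t _ => @newton_increment z v d z' t) _ fr).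
- by rewrite ?(addr_ge0, mulr_ge0, exprn_ge0, enorm_ge0).
- by rewrite ?(addr_ge0, mulr_ge0, exprn_ge0, enorm_ge0).
- by rewrite mulr_ge0 ?divr_ge0// ?(addr_ge0, mulr_ge0, enorm_ge0).
move=> d z' t d1 z'd td; rewrite -mulrBr.
have b20 : 0 <= beta / 2 by rewrite divr_ge0.
rewrite (le_trans (ler_wpM2l b20 (gy_sqr_increment v d1 z'd td)))//.
by rewrite mulrCA mulrDr [_ * (2 * _)]mulrA divfK ?pnatr_eq0// [_ * (_ * d)]mulrA.
Qed.

End newton.

(** * Exactness of the penalty and stationarity for the bilevel problem *)

Theorem theorem3p1 (R : realType) (n p : nat)
  (f g : 'rV[R]_n * 'rV[R]_p -> R)
  (* gx = ∇_x g, gy = ∇_y g, Hxy = ∇²_xy g (n x p), Hyy = ∇²_yy g (p x p) *)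
  (gx : 'rV[R]_n * 'rV[R]_p -> 'rV[R]_n)
  (gy : 'rV[R]_n * 'rV[R]_p -> 'rV[R]_p)
  (Hxy : 'rV[R]_n * 'rV[R]_p -> 'M[R]_(n, p))
  (Hyy : 'rV[R]_n * 'rV[R]_p -> 'M[R]_p)
  (Df : 'rV[R]_n * 'rV[R]_p -> set ('rV[R]_n * 'rV[R]_p))
  (Mf mu Lg Qg beta : R)
  (* (A1) *)
  (hMf : 0 < Mf) (hmu : 0 < mu) (hLg : 0 < Lg) (hQg : 0 < Qg)
  (f_lip : forall z z', `|f z - f z'| <= Mf * pnorm (z - z'))
  (g_diff : forall z, differentiable g z)
  (g_grad : forall z u, 'd g z u = dotv (gx z) u.1 + dotv (gy z) u.2)
  (gx_diff : forall z, differentiable gx z)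
  (gy_diff : forall z, differentiable gy z)
  (gy_hess : forall z u, 'd gy z u = u.1 *m Hxy z + u.2 *m Hyy z)
  (Hyy_pd : forall z v, mu * dotv v v <= dotv (v *m Hyy z) v)
  (grad_lip : forall z z',
     pnorm ((gx z - gx z', gy z - gy z') : 'rV[R]_n * 'rV[R]_p)
       <= Lg * pnorm (z - z'))
  (Hyy_lip : forall z z' (v : 'rV[R]_p),
     enorm (v *m (Hyy z - Hyy z')) <= Qg * pnorm (z - z') * enorm v)
  (Hxy_lip : forall z z' (v : 'rV[R]_p),
     enorm ((Hxy z - Hxy z') *m v^T)^T <= Qg * pnorm (z - z') * enorm v)
  (Hyy_diff : forall z, differentiable Hyy z)
  (Hyy_C1 : forall w, continuous (fun z => 'd Hyy z w))
  (* (A2) *)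
  (Df_cons : conservative_field Df)
  (Df_pot : potential_of f Df)
  (Df_convex : forall z, convex_pset (Df z))
  (Df_bound : forall z xi, Df z xi -> pnorm xi <= Mf)
  (* beta *)
  (hbeta : 0 < beta)
  (hbeta_ge : 2 * Qg * Mf / mu ^+ 3 <= beta)
  (x : 'rV[R]_n) (y : 'rV[R]_p) :
  let A := fun z : 'rV[R]_n * 'rV[R]_p =>
    z.2 - (invmx (Hyy z) *m (gy z)^T)^T in
  let h := fun z : 'rV[R]_n * 'rV[R]_p =>
    f (z.1, A z) + beta / 2 * enorm (gy z) ^+ 2 in
  clarke_subdiff h (x, y) (0 : 'rV[R]_n * 'rV[R]_p) ->
  gy (x, y) = 0 /\
  exists2 d : 'rV[R]_n * 'rV[R]_p, clarke_subdiff f (x, y) d &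
    d.1 - (Hxy (x, y) *m invmx (Hyy (x, y)) *m d.2^T)^T = 0.

Proof.
have mi0 : 0 <= mu^-1 by rewrite invr_ge0 ltW.
have gy_lip z z' : enorm (gy z - gy z') <= Lg * pnorm (z - z').
  rewrite (le_trans _ (grad_lip z z'))//.
  exact: (enorm_snd_le_pnorm ((gx z - gx z', gy z - gy z') : 'rV[R]_n * 'rV[R]_p)).
have Hsym := hessian_sym g_diff g_grad gy_diff gy_hess Hyy_lip (ltW hQg).
(* Symmetry of [Hyy] turns the column form of the Newton step into the row form of [newton]. *)
have AE z : z.2 - (invmx (Hyy z) *m (gy z)^T)^T = z.2 - gy z *m invmx (Hyy z).
  by rewrite trmx_mul trmxK trmx_inv Hsym.
move=> A h; set z : 'rV[R]_n * 'rV[R]_p := (x, y).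
have hE : h = fun z' => f (newton gy Hyy z') + beta / 2 * enorm (gy z') ^+ 2.
  by apply/funext => z'; rewrite /h /A AE.
rewrite hE => h0.
have penalty v r := clarke_dd_penalty_le (z := z) (v := v) (r := r) hmu (ltW hLg)
  (ltW hQg) gy_diff gy_hess gy_lip Hyy_pd Hyy_lip Hxy_lip (ltW hMf) (ltW hbeta) f_lip.
have pdot0 (v : 'rV[R]_n * 'rV[R]_p) : pdot 0 v = 0.
  by rewrite /pdot !dotv0l addr0.
have stat v r fr := le_trans (h0 v) (penalty v r fr).
have Hu := coercive_unitmx hmu (Hyy_pd z).
have gy0 : gy z = 0.
  apply: enorm_eq0; apply/eqP/negPn/negP => gyn0.
  have a0 : 0 < enorm (gy z) by rewrite lt_def gyn0 enorm_ge0.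
  pose v : 'rV[R]_n * 'rV[R]_p := (0, - (gy z *m invmx (Hyy z))).
  have dv : dgy Hxy Hyy z v = - gy z.
    by rewrite /dgy /v /= mul0mx add0r mulNmx mulmxKV.
  have f0 : (clarke_dd f (newton gy Hyy z)
      (v.1, (v.2 - dgy Hxy Hyy z v *m invmx (Hyy z))%R) <= 0%:E)%E.
    rewrite dv mulNmx opprK addNr.
    by have := clarke_dd_le_lipschitz f_lip (newton gy Hyy z) 0; rewrite pnorm0 mulr0.
  have := stat v 0 f0; rewrite pdot0 lee_fin add0r dv dotvNl -enorm_sqr pnorm_inr enormN.
  have u_le := enorm_mul_invmx hmu (Hyy_pd z) (gy z).
  set a := enorm (gy z) in a0 u_le *; set u := enorm _ in u_le *.
  (* By [u_le] the error is at most [Mf * Qg * a ^+ 2 / mu ^+ 3], hence at most [beta / 2 * a ^+ 2],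
     strictly below the decrease [beta * a ^+ 2]. *)
  have : Mf * (mu^-1 ^+ 2 * Qg * u * a) <= Mf * (mu^-1 ^+ 2 * Qg * (mu^-1 * a) * a).
    by rewrite ler_pM2l// ler_pM2r// ler_wpM2l// mulr_ge0 ?exprn_ge0 ?(ltW hQg).
  have a2 : 0 < a ^+ 2 by rewrite exprn_gt0.
  move: hbeta_ge; rewrite -exprVn => beta_ge.
  have := ler_wpM2r (ltW a2) beta_ge; have := mulr_gt0 hbeta a2.
  by lra.
split=> //.
have newtonz : newton gy Hyy z = z by rewrite /newton gy0 mul0mx subr0.
(* The range of [L] is the kernel of [dgy] at [z], that is, the directions tangent to the manifold
   [gy = 0]. *)
pose L (u : 'rV[R]_n) : 'rV[R]_n * 'rV[R]_p :=
  (u, - (u *m (Hxy z *m invmx (Hyy z)))).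
have L_lin : linear L.
  move=> a u u'; rewrite /L mulmxDl -scalemxAl opprD -scalerN.
  by [].
pose Lm : {linear 'rV[R]_n -> ('rV[R]_n * 'rV[R]_p)%type} := HB.pack L
  (GRing.isLinear.Build _ _ _ _ _ L_lin).
pose q v := fine (clarke_dd f z v).
have qs : sublinear q by exact: sublinear_clarke_dd f_lip z.
(* Along [(u, 0)] the linearized Newton map moves by [L u]; its error and the penalty slope vanish
   with [gy z]. *)
have qL u : 0 <= q (L u).
  have fr : (clarke_dd f (newton gy Hyy z)
      (u, (0 - dgy Hxy Hyy z (u, 0) *m invmx (Hyy z))%R) <= (q (L u))%:E)%E.
    by rewrite newtonz (clarke_dd_fineK f_lip) /dgy mul0mx addr0 sub0r -mulmxA.
  have := stat (u, 0) _ fr.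
  by rewrite pdot0 lee_fin gy0 enorm0 dotv0r !mulr0 !addr0.
(* The minorant is nonpositive on the range of [L], so a linear form below it is nonpositive there,
   and zero by the change of sign of [u]. *)
have [q' [q's q'q q'L]] :=
  @sublinear_dominated _ _ _ q Lm (\0 : {scalar 'rV[R]_n}) qs qL.
have [d dq'] := hahn_banach_pair q's.
exists d.
  by apply/(clarke_subdiff_fineP f_lip) => v; rewrite (le_trans (dq' v)).
apply: dotv_nondegenerate => u.
have dL u' : pdot d (L u') <= 0 by rewrite (le_trans (dq' _)) ?q'L.
have dotL u' : pdot d (L u') =
    dotv (d.1 - (Hxy z *m invmx (Hyy z) *m d.2^T)^T) u'.
  rewrite /pdot /L /= dotvNr dotvBl (dotvC _ u') (dotvC d.2) dotv_mulmx.
  by rewrite (dotvC u' d.1) (dotvC u').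
have := dL (- u); have := dL u; rewrite !dotL dotvNr oppr_le0 => u0 u1.
by apply/eqP; rewrite eq_le u0.
Qed.
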